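(* A $p$-local finite group $(S,\mathcal F,\mathcal L)$ is nilpotent if and only if one of the following four conditions is satisfied: (1) two elements $a,b\in S$ are $\mathcal F$-conjugate if and only if they are $S$-conjugate; (2) for some integer $n>1$, two $n$-tuples of pairwise commuting elements of $S$ are $\mathcal F$-conjugate if and only if they are $S$-conjugate; (3) for every subgroup $P\le S$, $\mathrm{Aut}_{\mathcal F}(P)$ is a $p$-group; (4) for every $\mathcal F$-centric subgroup $P\le S$, $\mathrm{Aut}_{\mathcal F}(P)$ is a $p$-group.
   Context: Elements $a,b\in S$ are $\mathcal F$-conjugate if there is $\phi\in\mathrm{Hom}_{\mathcal F}(\langle a\rangle,S)$ with $\phi(a)=b$, and $S$-conjugate if $b=sas^{-1}$ for some $s\in S$. Two $n$-tuples $(a_1,\dots,a_n)$, $(b_1,\dots,b_n)$ of commuting elements of $S$ are $\mathcal F$-conjugate if there is $\phi\in\mathrm{Hom}_{\mathcal F}(\langle a_1,\dots,a_n\rangle,S)$ with $\phi(a_i)=b_i$ for all $i$, and $S$-conjugate if there is $s\in S$ with $sa_is^{-1}=b_i$ for all $i$. Let $p$ be a prime and $S$ a finite $p$-group. For $P,Q\le S$, $\mathrm{Hom}_S(P,Q)$ is the set of maps $c_g\colon x\mapsto gxg^{-1}$ with $g\in S$, $gPg^{-1}\le Q$, and $\mathrm{Aut}_S(P)=\mathrm{Hom}_S(P,P)$. A fusion system $\mathcal F$ over $S$ is a category whose objects are the subgroups of $S$, with $\mathrm{Hom}_S(P,Q)\subseteq\mathrm{Hom}_{\mathcal F}(P,Q)\subseteq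 \mathrm{Inj}(P,Q)$, such that every morphism factors as an $\mathcal F$-isomorphism followed by an inclusion; $\mathrm{Aut}_{\mathcal F}(P)$ is the group of $\mathcal F$-automorphisms of $P$. Subgroups are $\mathcal F$-conjugate if they are isomorphic in $\mathcal F$. $P$ is fully centralized (resp. fully normalized) if $|C_S(P)|\ge |C_S(P')|$ (resp. $|N_S(P)|\ge|N_S(P')|$) for all $P'$ $\mathcal F$-conjugate to $P$. $\mathcal F$ is saturated if (I) every fully normalized $P$ is fully centralized and $\mathrm{Aut}_S(P)$ is a Sylow $p$-subgroup of $\mathrm{Aut}_{\mathcal F}(P)$, and (II) whenever $\phi\in\mathrm{Hom}_{\mathcal F}(P,S)$ with $\phi(P)$ fully centralized, $\phi$ extends to a morphism in $\mathcal F$ defined on $N_\phi=\{g\in N_S(P):\phi c_g\phi^{-1}\in \mathrm{Aut}_S(\phi(P))\}$. $P$ is $\mathcal F$-centric if $C_S(P')\le P'$ for all $P'$ $\mathcal F$-conjugate to $P$; $\mathcal F^c$ is the full subcategory on these. A centric linking system associated to $\mathcal F$ is a category $\mathcal L$ with objects the $\mathcal F$-centric subgroups, a functor $\pi\colon\mathcal L\to\mathcal F^c$ which is the identity on objects, and monomorphisms $\delta_P\colon P\to\mathrm{Aut}_{\mathcal L}(P)$, such that (A) $Z(P)$ (via $\delta_P$) acts freely on $\mathrm{Mor}_{\mathcal L}(P,Q)$ by composition and $\pi$ induces a bijection $\mathrm{Mor}_{\mathcal L}(P,Q)/Z(P)\to\mathrm{Hom}_{\mathcal F}(P,Q)$;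 (B) $\pi(\delta_P(g))=c_g$ for $g\in P$; (C) $f\circ\delta_P(g)=\delta_Q(\pi(f)(g))\circ f$ for $f\in\mathrm{Mor}_{\mathcal L}(P,Q)$, $g\in P$. A $p$-local finite group is a triple $(S,\mathcal F,\mathcal L)$ with $\mathcal F$ a saturated fusion system over $S$ and $\mathcal L$ an associated centric linking system. $(S,\mathcal F,\mathcal L)$ is called nilpotent if $\mathcal F=\mathcal F_S(S)$, the fusion system with $\mathrm{Hom}_{\mathcal F_S(S)}(P,Q)=\mathrm{Hom}_S(P,Q)$. *)

(* Defs.v *)
From HB Require Import structures.
From mathcomp Require Import all_boot all_order all_fingroup all_solvable.
Set Implicit Arguments. Unset Strict Implicit. Unset Printing Implicit Defensive.
Local Open Scope group_scope.

(* Conventions: a morphism P -> Q of a fusion system is represented by a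
   finite function phi : {ffun gT -> gT} that is an injective homomorphism
   on P with image in Q and is normalized to 1 outside P.  A fusion system
   is given as F : {set gT} -> {set gT} -> {set {ffun gT -> gT}},
   F P Q = Hom_F(P,Q); only its values on subgroups of S matter. *)

Section Defs.
Variables (gT : finGroupType).
Implicit Types (S P Q R : {group gT}).
Notation morT := {ffun gT -> gT}.
Notation fusT := ({set gT} -> {set gT} -> {set morT}).

Definition conjmap (P : {set gT}) (g : gT) : morT :=
  [ffun x => if x \in P then g * x * g^-1 else 1].

Definition compmap (P : {set gT}) (g f : morT) : morT :=
  [ffun x => if x \in P then g (f x) else 1].

Definition injhom (P Q : {set gT}) (f : morT) : Prop :=
  [/\ {in P &, {morph f : x y / x * y}}, {in P &, injective f},
      f @: P \subset Q & forall x, x \notin P -> f x = 1].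

Definition HomS (S : {set gT}) (P Q : {set gT}) : {set morT} :=
  [set conjmap P g | g in S & (P :^ g^-1) \subset Q].

Definition fusion_system S (F : fusT) : Prop :=
  [/\ (forall P Q, P \subset S -> Q \subset S ->
         HomS S P Q \subset F P Q /\ (forall f, f \in F P Q -> injhom P Q f)),
      (forall P Q R, P \subset S -> Q \subset S -> R \subset S ->
         forall f g, f \in F P Q -> g \in F Q R -> compmap P g f \in F P R) &
      (forall P Q, P \subset S -> Q \subset S -> forall f, f \in F P Q ->
         exists R : {group gT}, [/\ (R : {set gT}) = f @: P, f \in F P R &
           exists2 g, g \in F R P & {in P, forall x, g (f x) = x}])].

Definition Fconj_sub (F : fusT) (P P' : {set gT}) : Prop :=
  exists2 f, f \in F P P' & f @: P = P'.

Definition fully_centralized S (F : fusT) P : Prop :=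
  forall P' : {group gT}, P' \subset S -> Fconj_sub F P P' ->
    #|'C_S(P')| <= #|'C_S(P)|.

Definition fully_normalized S (F : fusT) P : Prop :=
  forall P' : {group gT}, P' \subset S -> Fconj_sub F P P' ->
    #|'N_S(P')| <= #|'N_S(P)|.

Definition sylow_in (p : nat) (A B : {set morT}) : Prop :=
  [/\ A \subset B, p.-nat #|A| & p^'.-nat (#|B| %/ #|A|)].

(* N_phi = { g in N_S(P) : phi c_g phi^-1 in Aut_S(phi(P)) } *)
Definition Nphi S (P : {set gT}) (phi : morT) : {set gT} :=
  [set g in 'N_S(P) | [exists h in S,
      (((phi @: P) :^ h^-1) \subset phi @: P) &&
      [forall x in P, phi (g * x * g^-1) == h * phi x * h^-1]]].

Definition saturated (p : nat) S (F : fusT) : Prop :=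
  [/\ fusion_system S F,
      (forall P, P \subset S -> fully_normalized S F P ->
         fully_centralized S F P /\ sylow_in p (HomS S P P) (F P P)) &
      (forall P, P \subset S -> forall phi, phi \in F P S ->
         forall R : {group gT}, (R : {set gT}) = phi @: P ->
         fully_centralized S F R ->
         exists2 psi, psi \in F (Nphi S P phi) S & {in P, psi =1 phi})].

Definition Fcentric S (F : fusT) P : Prop :=
  P \subset S /\
  forall P' : {group gT}, P' \subset S -> Fconj_sub F P P' ->
    'C_S(P') \subset P'.

Definition nilpotent_fus S (F : fusT) : Prop :=
  forall P Q, P \subset S -> Q \subset S -> F P Q = HomS S P Q.

End Defs.

(* Data of a category L with objects subgroups, composition Lcomp g f = g o f,
   functor Lpi to the fusion system, and maps Ldelta P : P -> Aut_L(P). *)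
Record linking_data (gT : finGroupType) := LinkingData {
  Lmor : Type;
  Lsrc : Lmor -> {group gT};
  Ltgt : Lmor -> {group gT};
  Lcomp : Lmor -> Lmor -> Lmor;
  Lid : {group gT} -> Lmor;
  Lpi : Lmor -> {ffun gT -> gT};
  Ldelta : {group gT} -> gT -> Lmor }.

Section Linking.
Variables (gT : finGroupType).
Local Open Scope group_scope.
Notation fusT := ({set gT} -> {set gT} -> {set {ffun gT -> gT}}).

Definition linking_system (S : {group gT}) (F : fusT) (L : linking_data gT)
    : Prop :=
  let src := @Lsrc _ L in let tgt := @Ltgt _ L in let comp := @Lcomp _ L in
  let pi := @Lpi _ L in let delta := @Ldelta _ L in
  (forall f, Fcentric S F (src f) /\ Fcentric S F (tgt f)) /\
  (forall P : {group gT}, Fcentric S F P ->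
     src (@Lid _ L P) = P /\ tgt (@Lid _ L P) = P) /\
  (forall f g, src g = tgt f ->
     src (comp g f) = src f /\ tgt (comp g f) = tgt g) /\
  (forall f g h, src g = tgt f -> src h = tgt g ->
     comp h (comp g f) = comp (comp h g) f) /\
  (forall f, comp f (@Lid _ L (src f)) = f /\ comp (@Lid _ L (tgt f)) f = f) /\
  (forall f, pi f \in F (src f) (tgt f)) /\
  (forall P : {group gT}, Fcentric S F P -> pi (@Lid _ L P) = conjmap P 1) /\
  (forall f g, src g = tgt f ->
     pi (comp g f) = compmap (src f) (pi g) (pi f)) /\
  (forall P : {group gT}, Fcentric S F P ->
     [/\ {in P, forall g, src (delta P g) = P /\ tgt (delta P g) = P},
         delta P 1 = @Lid _ L P,
         {in P &, forall g h, delta P (g * h) = comp (delta P g) (delta P h)} &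
         {in P &, injective (delta P)}]) /\
  (* (A): Z(P) acts freely on Mor(P,Q), and pi induces a bijection
     Mor(P,Q)/Z(P) -> Hom_F(P,Q) *)
  (forall f, {in 'Z(src f), forall z, comp f (delta (src f) z) = f -> z = 1}) /\
  (forall P Q : {group gT}, Fcentric S F P -> Fcentric S F Q ->
     forall phi, phi \in F P Q ->
     exists f, [/\ src f = P, tgt f = Q & pi f = phi]) /\
  (forall f f', src f = src f' -> tgt f = tgt f' -> pi f = pi f' ->
     exists2 z, z \in 'Z(src f) & f' = comp f (delta (src f) z)) /\
  (forall P : {group gT}, Fcentric S F P ->
     {in P, forall g, pi (delta P g) = conjmap P g}) /\
  (forall f, {in src f, forall g,
     comp f (delta (src f) g) = comp (delta (tgt f) (pi f g)) f}).

Definition Fconj_tuple (F : fusT) (S : {set gT}) n (a b : n.-tuple gT) : Prop :=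
  exists2 phi, phi \in F <<[set tnth a i | i : 'I_n]>> S &
    forall i, phi (tnth a i) = tnth b i.

Definition Sconj_tuple (S : {set gT}) n (a b : n.-tuple gT) : Prop :=
  exists2 s, s \in S & forall i, s * tnth a i * s^-1 = tnth b i.

Definition commuting_in (S : {set gT}) n (a : n.-tuple gT) : Prop :=
  (forall i, tnth a i \in S) /\ (forall i j, commute (tnth a i) (tnth a j)).

End Linking.

(* Main.v *)
(** Condition (2) gives (1) by taking constant tuples, and
    nilpotency gives (2) at once.
    (1) implies (3): if phi in Aut_F(P) sends every x in P to an S-conjugate of
    x, then phi acts trivially on the factors of the series P :&: 'Z_i(S), so
    its order is a power of p.
    (4) implies nilpotency: by downward induction on |P|, every morphism
    P -> S is conjugation by an element of S.  Let R be a fully normalized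
    F-conjugate of P.  If R is centric then Aut_S(R) is a Sylow subgroup of the
    p-group Aut_F(R), so they are equal; otherwise every automorphism of R
    extends to C_S(R)R > R, and induction gives Aut_F(R) = Aut_S(R) again.
    Hence any isomorphism psi : P' -> R has N_psi = N_S(P') > P', so psi
    extends and is an S-conjugation by induction.  A morphism phi : P -> P' is
    a quotient of two such isomorphisms. *)

Require Import Defs.
From mathcomp Require Import all_boot all_order all_fingroup all_solvable.
Set Implicit Arguments. Unset Strict Implicit. Unset Printing Implicit Defensive.
Local Open Scope group_scope.

(** * Morphisms as finite functions, and the group [Nphi] *)

Section Morphisms.
Variable gT : finGroupType.
Implicit Types (P Q R S : {group gT}) (A B C : {set gT}) (f phi : {ffun gT -> gT}).

Lemma conjVgE (x g : gT) : x ^ g^-1 = g * x * g^-1.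
Proof. by rewrite conjgE invgK mulgA. Qed.

Lemma conjmapE A g x : x \in A -> conjmap A g x = x ^ g^-1.
Proof. by move=> Ax; rewrite ffunE Ax conjVgE. Qed.

Lemma compmapE A (g f : {ffun gT -> gT}) x : x \in A -> compmap A g f x = g (f x).
Proof. by move=> Ax; rewrite ffunE Ax. Qed.

Lemma imset_conjmap A g : conjmap A g @: A = A :^ g^-1.
Proof. by apply: eq_in_imset => x; apply: conjmapE. Qed.

Lemma HomSP A B C f :
  reflect (exists g, [/\ g \in A, B :^ g^-1 \subset C & f = conjmap B g])
          (f \in HomS A B C).
Proof.
apply: (iffP imsetP) => [[g] | [g [Ag sBC ->]]].
  by rewrite inE => /andP[Ag sBC] ->; exists g.
by exists g => //; rewrite inE Ag.
Qed.

Lemma NphiP P A phi g :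
  reflect (g \in 'N_P(A) /\ exists2 h, h \in P &
             (phi @: A) :^ h^-1 \subset phi @: A /\
             {in A, forall x, phi (g * x * g^-1) = h * phi x * h^-1})
          (g \in Nphi P A phi).
Proof.
rewrite [g \in Nphi P A phi]in_set; apply: (iffP andP) => -[Ng].
  case/exists_inP=> h Ph /andP[nh /forall_inP E]; split=> //.
  by exists h => //; split=> // x /E/eqP.
case=> h Ph [nh E]; split=> //; apply/exists_inP; exists h; rewrite // nh.
by apply/forall_inP=> x /E ->.
Qed.

(** Makes [Nphi] a subgroup to which an induction hypothesis can be applied. If [h1] and [h2]
    realize the transported actions of [g1] and [g2], then [h1 * h2] realizes that of [g1 * g2]. *)
Lemma Nphi_group_set P Q phi : group_set (Nphi P Q phi).
Proof.
apply/group_setP; split=> [|g1 g2].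
  apply/NphiP; split; rewrite ?group1 //; exists 1; rewrite ?group1 //.
  rewrite invg1 conjsg1; split=> // x Qx.
  by rewrite !mulg1 !mul1g.
case/NphiP=> Ng1 [h1 Ph1 [n1 E1]] /NphiP[Ng2 [h2 Ph2 [n2 E2]]].
apply/NphiP; split; rewrite ?groupM //; exists (h1 * h2); rewrite ?groupM //.
rewrite invMg conjsgM; split=> [|x Qx].
  by rewrite (subset_trans _ n1) ?conjSg // sub_conjgV -sub_conjg.
have [_ Ng2P] := setIP Ng2.
have /E1 : g2 * x * g2^-1 \in Q by rewrite -conjVgE memJ_norm ?groupV.
by rewrite E2 // invMg !mulgA.
Qed.

Lemma injhom_mem A B f x : injhom A B f -> x \in A -> f x \in B.
Proof. by case=> _ _ sfB _ Ax; rewrite (subsetP sfB) // imset_f. Qed.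

Lemma injhom1 P A f : injhom P A f -> f 1 = 1.
Proof. by case=> fM _ _ _; apply: (mulgI (f 1)); rewrite -fM ?mulg1. Qed.

Lemma injhomV P A f : injhom P A f -> {in P, {morph f : x / x^-1}}.
Proof.
move=> f_hom x Px; have [fM _ _ _] := f_hom; apply: (mulgI (f x)).
by rewrite -fM ?groupV // !mulgV (injhom1 f_hom).
Qed.

Lemma injhomJ P A f : injhom P A f -> {in P &, {morph f : x y / x ^ y}}.
Proof.
move=> f_hom x y Px Py; have [fM _ _ _] := f_hom.
by rewrite !conjgE !fM ?groupM ?groupV // (injhomV f_hom).
Qed.

Lemma injhom_card A B f : injhom A B f -> #|f @: A| = #|A|.
Proof. by case=> _ fI _ _; apply: card_in_imset. Qed.

End Morphisms.

(** * Restriction, change of target and inversion in a fusion system *)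

Section FusionSystem.
Variables (gT : finGroupType) (S : {group gT}).
Variable F : {set gT} -> {set gT} -> {set {ffun gT -> gT}}.
Hypothesis fusF : fusion_system S F.
Implicit Types (P Q R : {group gT}) (f phi psi : {ffun gT -> gT}).

Lemma fus_hom P Q f : P \subset S -> Q \subset S -> f \in F P Q -> injhom P Q f.
Proof. by move=> sP sQ; case: fusF => H _ _; case: (H P Q sP sQ) => _; apply. Qed.

Lemma fus_HomS P Q : P \subset S -> Q \subset S -> HomS S P Q \subset F P Q.
Proof. by move=> sP sQ; case: fusF => H _ _; case: (H P Q sP sQ). Qed.

Lemma fus_conj P Q g :
  P \subset S -> Q \subset S -> g \in S -> P :^ g^-1 \subset Q ->
  conjmap P g \in F P Q.
Proof.
by move=> sP sQ Sg sPQ; apply: (subsetP (fus_HomS sP sQ)); apply/HomSP; exists g.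
Qed.

Lemma fus_incl P Q :
  P \subset Q -> Q \subset S -> conjmap P 1 \in F P Q.
Proof.
by move=> sPQ sQ; apply: fus_conj; rewrite ?(subset_trans sPQ) ?invg1 ?conjsg1.
Qed.

Lemma fus_comp P Q R f g :
  P \subset S -> Q \subset S -> R \subset S ->
  f \in F P Q -> g \in F Q R -> compmap P g f \in F P R.
Proof. by move=> sP sQ sR Ff Fg; case: fusF => _ H _; apply: (H P Q R). Qed.

Lemma fus_restr P Q R f :
  P \subset Q -> Q \subset S -> R \subset S -> f \in F Q R ->
  exists2 f', f' \in F P R & {in P, f' =1 f}.
Proof.
move=> sPQ sQ sR Ff; exists (compmap P f (conjmap P 1)) => [|x Px].
  by apply: fus_comp Ff; rewrite ?(subset_trans sPQ) ?fus_incl.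
by rewrite compmapE // conjmapE // invg1 conjg1.
Qed.

Lemma fus_widen P Q R f :
  P \subset S -> Q \subset R -> R \subset S -> f \in F P Q -> f \in F P R.
Proof.
move=> sP sQR sR Ff; have sQ := subset_trans sQR sR.
have f_hom := fus_hom sP sQ Ff.
(* Composing with the inclusion of [Q] returns the very same function, because [f] is already 1
   outside [P]. *)
suff <- : compmap P (conjmap Q 1) f = f by apply: fus_comp (fus_incl _ _).
apply/ffunP=> x; rewrite ffunE; case: ifPn => Px.
  by rewrite conjmapE ?(injhom_mem f_hom) // invg1 conjg1.
by case: f_hom => _ _ _ ->.
Qed.

Lemma fus_image P f : P \subset S -> f \in F P S ->
  exists R, [/\ R = f @: P :> {set gT}, R \subset S, f \in F P R &
    exists2 g, g \in F R P & {in P, cancel f g}].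
Proof.
move=> sP Ff; case: fusF => _ _ H.
have [R [defR FfR Fg]] := H P S sP (subxx S) f Ff.
by exists R; split=> //; rewrite defR; case: (fus_hom sP (subxx S) Ff).
Qed.

Lemma fus_iso_inv P R f : P \subset S -> R \subset S ->
    f \in F P R -> f @: P = R ->
  exists g, [/\ g \in F R P, g @: R = P, {in P, cancel f g} & {in R, cancel g f}].
Proof.
move=> sP sR Ff defR.
have [R' [defR' sR' _ [g Fg fK]]] := fus_image sP (fus_widen sP sR (subxx S) Ff).
have eqR : R' = R by apply: val_inj; rewrite /= defR' defR.
rewrite {}eqR in Fg; exists g; split=> //.
  rewrite -defR -imset_comp -[RHS]imset_id.
  by apply: eq_in_imset => x Px; apply: fK.
by move=> y; rewrite -defR => /imsetP[x Px ->]; rewrite fK.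
Qed.

(** * Conjugacy of subgroups in [F] *)

Lemma Fconj_trans P Q R : P \subset S -> Q \subset S -> R \subset S ->
  Fconj_sub F P Q -> Fconj_sub F Q R -> Fconj_sub F P R.
Proof.
move=> sP sQ sR [f Ff defQ] [g Fg defR].
exists (compmap P g f); first exact: fus_comp Fg.
rewrite -defR -defQ -imset_comp; apply: eq_in_imset => x Px.
exact: compmapE.
Qed.

Lemma Fconj_refl P : P \subset S -> Fconj_sub F P P.
Proof.
move=> sP; exists (conjmap P 1); first exact: fus_incl.
by rewrite imset_conjmap invg1 conjsg1.
Qed.

Lemma Fconj_sym P R : P \subset S -> R \subset S ->
  Fconj_sub F P R -> Fconj_sub F R P.
Proof.
move=> sP sR [f Ff defR]; have [g [Fg defP _ _]] := fus_iso_inv sP sR Ff defR.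
by exists g.
Qed.

Lemma Fconj_card P R : P \subset S -> R \subset S -> Fconj_sub F P R -> #|P| = #|R|.
Proof.
by move=> sP sR [f Ff defR]; rewrite -(injhom_card (fus_hom sP sR Ff)) defR.
Qed.

(** Among the finitely many [F]-conjugates of [P], take one with the largest normalizer; by
    transitivity its own conjugates are among them. *)
Lemma fully_normalized_exists P : P \subset S ->
  exists R, [/\ R \subset S, Fconj_sub F P R & fully_normalized S F R].
Proof.
move=> sP.
pose conjP (R : {group gT}) := (R \subset S) && [exists f in F P R, f @: P == R].
have conjPP R : R \subset S -> reflect (Fconj_sub F P R) (conjP R).
  move=> sR; rewrite /conjP sR; apply: (iffP existsP) => [[f] | [f Ff /eqP defR]].
    by case/andP=> Ff /eqP defR; exists f.
  by exists f; rewrite Ff.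
have PP : conjP P by apply/(conjPP P sP)/Fconj_refl.
have [R PR maxR] := arg_maxnP (fun R : {group gT} => #|'N_S(R)|) PP.
have [sR _] := andP PR; have cPR := conjPP _ sR PR.
exists R; split=> // R' sR' cRR'; apply: maxR.
by apply/(conjPP R' sR'); apply: Fconj_trans cRR'.
Qed.

(** Here ['C_S(R)] equals ['Z(R)], and [f] embeds ['Z(R)] in ['Z(R')]. Hence ['C_S(R')] has at most
    as many elements as its subgroup ['Z(R')], and the two coincide. *)
Lemma fully_centralized_centric R :
  R \subset S -> fully_centralized S F R -> 'C_S(R) \subset R -> Fcentric S F R.
Proof.
move=> sR fcR sCR; split=> // R' sR' cRR'; have [f Ff defR'] := cRR'.
have [fM fI _ _] := fus_hom sR sR' Ff.
have sZC : 'Z(R') \subset 'C_S(R') by rewrite setSI.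
suff /eqP <- : 'Z(R') == 'C_S(R') :> {set gT} by apply: center_sub.
rewrite eqEcard sZC (leq_trans (fcR R' sR' cRR')) //.
have sCZ : 'C_S(R) \subset 'Z(R) by rewrite subsetI sCR subsetIr.
rewrite (leq_trans (subset_leq_card sCZ)) //.
rewrite -(card_in_imset (sub_in2 (subsetP (center_sub R)) fI)) subset_leq_card //.
apply/subsetP=> _ /imsetP[z /centerP[Rz cRz] ->]; apply/centerP.
split=> [|y]; first by rewrite -defR' imset_f.
by rewrite -defR' => /imsetP[x Rx ->]; rewrite /commute -!fM ?cRz.
Qed.

(** * Subgroups contained in [Nphi], and extension of morphisms *)

Lemma sub_Nphi P phi : P \subset S -> phi \in F P S -> P \subset Nphi S P phi.
Proof.
move=> sP Fphi; have phi_hom := fus_hom sP (subxx S) Fphi.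
have [phiM _ _ _] := phi_hom.
apply/subsetP=> g Pg; apply/NphiP; split.
  by rewrite inE (subsetP sP) // (subsetP (normG P)).
(* Transporting conjugation by [g] along [phi] gives conjugation by [phi g]. *)
exists (phi g); first exact: injhom_mem phi_hom Pg.
rewrite -(injhomV phi_hom) //; split=> [|x Px]; last by rewrite -!phiM ?groupM ?groupV.
apply/subsetP=> _ /imsetP[_ /imsetP[x Px ->] ->].
by rewrite -(injhomJ phi_hom) ?groupV // imset_f // groupJ ?groupV.
Qed.

(** An element centralizing [P] acts trivially on it, so the transported action is that of
    [h = 1]. *)
Lemma cent_sub_Nphi P phi : 'C_S(P) \subset Nphi S P phi.
Proof.
apply/subsetP=> g CPg; have [Sg cPg] := setIP CPg; apply/NphiP; split.
  by rewrite (subsetP (setIS _ (cent_sub P))).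
exists 1 => //; rewrite invg1 conjsg1; split=> // x Px.
by rewrite (centP cPg x Px) mulgK mul1g mulg1.
Qed.

(** Transporting conjugation by [g] along the isomorphism [psi] gives an [F]-automorphism of [R],
    which by hypothesis is conjugation by some [h] in [S]. *)
Lemma norm_sub_Nphi P R psi : P \subset S -> R \subset S ->
  F R R = HomS S R R -> psi \in F P R -> psi @: P = R ->
  'N_S(P) \subset Nphi S P psi.
Proof.
move=> sP sR AutR Fpsi defR; apply/subsetP=> g NPg; apply/NphiP; split=> //.
have [psi' [Fpsi' _ psiK _]] := fus_iso_inv sP sR Fpsi defR.
have [Sg NPg'] := setIP NPg.
have nPg : P :^ g^-1 = P by apply/normP; rewrite groupV.
have Fg : conjmap P g \in F P P by apply: fus_conj; rewrite ?nPg.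
have /HomSP[h [Sh nRh E]] :
    compmap R psi (compmap R (conjmap P g) psi') \in HomS S R R.
  rewrite -AutR; apply: fus_comp Fpsi => //; apply: fus_comp Fg => //.
exists h; rewrite // defR; split=> // x Px.
have Rx : psi x \in R by rewrite -defR imset_f.
have := congr1 (fun f : {ffun gT -> gT} => f (psi x)) E.
by rewrite compmapE // compmapE // psiK // !conjmapE // !conjVgE.
Qed.

Lemma conj_of_extension P phi psi :
  P \subset S -> phi \in F P S ->
  forall N : {group gT}, P \subset N -> psi \in HomS S N S ->
  {in P, psi =1 phi} -> phi \in HomS S P S.
Proof.
move=> sP Fphi N sPN /HomSP[g [Sg sNS ->]] E; apply/HomSP; exists g; split=> //.
  by rewrite (subset_trans _ sNS) ?conjSg.
have [_ _ _ phi1] := fus_hom sP (subxx S) Fphi.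
apply/ffunP=> x; rewrite ffunE; case: ifPn => Px; last exact: phi1.
by rewrite -E // conjmapE ?(subsetP sPN) // conjVgE.
Qed.

(* A group of permutations all of whose elements have p-power order is a
   p-group by Cauchy; morphisms are extended by the identity outside P. *)
Lemma Aut_pnat p P : prime p -> P \subset S ->
  (forall f, f \in F P P -> exists k, {in P, forall x, iter (p ^ k) f x = x}) ->
  p.-nat #|F P P|.
Proof.
move=> p_pr sP ordF.
pose r (s : {perm gT}) : {ffun gT -> gT} := [ffun x => if x \in P then s x else 1].
(* [r] will be a bijection from the permutation group [A] onto [F P P], so Cauchy's theorem for [A]
   bounds the primes dividing [#|F P P|]. *)
pose A := [set s | perm_on P s & r s \in F P P].
have gA : group_set A.
  apply/group_setP; split=> [|s t].
    rewrite inE perm_on1; suff -> : r 1 = conjmap P 1 by rewrite fus_incl.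
    by apply/ffunP=> x; rewrite !ffunE perm1 mul1g invg1 mulg1.
  rewrite !inE => /andP[Ps Fs] /andP[Pt Ft]; rewrite perm_onM //.
  suff -> : r (s * t) = compmap P (r t) (r s) by apply: fus_comp Ft.
  apply/ffunP=> x; rewrite !ffunE; case: ifP => // Px.
  by rewrite permM (perm_closed x Ps) Px.
have defF : r @: A = F P P.
  apply/setP=> f; apply/imsetP/idP=> [[s] | Ff]; first by rewrite inE => /andP[_ Fs] ->.
  have f_hom := fus_hom sP sP Ff; have [_ fI _ f1] := f_hom.
  pose f' x := if x \in P then f x else x.
  have f'I : injective f'.
    move=> x y; rewrite /f'; case: ifPn => Px; case: ifPn => Py //; first exact: fI.
      by move=> E; rewrite -E (injhom_mem f_hom) in Py.
    by move=> E; rewrite E (injhom_mem f_hom) in Px.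
  have rf : r (perm f'I) = f.
    by apply/ffunP=> x; rewrite ffunE; case: ifPn => [Px|/f1 //]; rewrite permE /f' Px.
  exists (perm f'I); rewrite // inE rf Ff andbT.
  by apply/subsetP=> x; rewrite inE permE /f'; case: ifP; rewrite // eqxx.
have rI : {in A &, injective r}.
  move=> s t; rewrite !inE => /andP[Ps _] /andP[Pt _] E; apply/permP=> x.
  case: (boolP (x \in P)) => Px; last by rewrite (out_perm Ps) ?(out_perm Pt).
  by have /ffunP/(_ x) := E; rewrite !ffunE Px.
rewrite -defF (card_in_imset rI) -[A]/(gval (Group gA)).
apply/pgroupP=> q q_pr /(Cauchy q_pr)[s]; rewrite inE => /andP[Ps Fs] ord_s.
have [k Ek] := ordF _ Fs.
have s1 : s ^+ (p ^ k) = 1.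
  apply/permP=> x; rewrite perm1 permX.
  case: (boolP (x \in P)) => Px; last first.
    by elim: (p ^ k)%N => //= n ->; rewrite (out_perm Ps).
  rewrite -[RHS](Ek x Px); suff [] :
    iter (p ^ k) s x = iter (p ^ k) (r s) x /\ iter (p ^ k) s x \in P by [].
  elim: (p ^ k)%N => //= n [<- Pn].
  by rewrite ffunE Pn (perm_closed _ Ps) Pn.
have dvd_q : q %| p ^ k by rewrite -ord_s order_dvdn s1.
by rewrite -pnatE // (pnat_dvd dvd_q) // pnatX pnat_id.
Qed.

End FusionSystem.

(** * Automorphisms that keep every element in its [S]-class *)

Section Nilpotency.
Variables (gT : finGroupType) (p : nat) (S : {group gT}).
Variable F : {set gT} -> {set gT} -> {set {ffun gT -> gT}}.
Hypotheses (p_pr : prime p) (pS : p.-group S).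
Implicit Types (P Q R : {group gT}) (f phi psi : {ffun gT -> gT}).

Lemma iter_injhom P f n : injhom P P f ->
  {in P &, {morph iter n f : x y / x * y}} /\ {in P, forall x, iter n f x \in P}.
Proof.
move=> f_hom; have [fM _ _ _] := f_hom; elim: n => [|n [IHM IHP]]; first by split.
split=> [x y Px Py | x Px]; first by rewrite !iterS IHM // fM ?IHP.
by rewrite (injhom_mem f_hom) ?IHP.
Qed.

(* [f] acts trivially on the factors of the series [P :&: 'Z_i(S)] because
   [x^-1 * (s * x * s^-1)] lies in ['Z_i(S)] for [x] in ['Z_i.+1(S)]. *)
Lemma iter_ucn P f : P \subset S -> injhom P P f ->
  (forall x, x \in P -> exists2 s, s \in S & f x = s * x * s^-1) ->
  forall i, {in P :&: 'Z_i(S), forall x, iter (#|S| ^ i) f x = x}.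
Proof.
move=> sP f_hom f_conj; elim=> [|i IHi] x /setIP[Px].
  by rewrite ucn0 => /set1P ->; rewrite /= (injhom1 f_hom).
move=> Zx; set m := (#|S| ^ i)%N.
have [psiM psiP] := iter_injhom m f_hom.
have stepZ y : y \in P -> y \in 'Z_i.+1(S) -> y^-1 * f y \in 'Z_i(S).
  move=> Py Zy; have [s Ss ->] := f_conj y Py.
  rewrite -conjVgE; apply: (subsetP (ucn_comm i S)).
  by apply: mem_commg; rewrite ?groupV.
have cZ n : x^-1 * iter n f x \in 'Z_i(S).
  elim: n => [|n IHn]; first by rewrite mulVg.
  have [_ fnP] := iter_injhom n f_hom; have Pn := fnP x Px.
  have Zn : iter n f x \in 'Z_i.+1(S).
    by rewrite -(groupMl _ (groupVr Zx)); apply: (subsetP (ucn_subS i S)).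
  by have := groupM IHn (stepZ _ Pn Zn); rewrite -mulgA mulKVg.
set c := x^-1 * iter m f x; have Zc : c \in 'Z_i(S) := cZ m.
have Pc : c \in P by rewrite groupM ?groupV ?psiP.
have psic : iter m f c = c by apply: IHi; rewrite inE Pc.
have psix : iter m f x = x * c by rewrite mulKVg.
(* The [m]-th iterate of [f] fixes [c] by induction and sends [x] to [x * c], so repeating it
   multiplies by [c] each time; after [#|S|] repetitions the factor is 1. *)
have iter_c n : iter n (iter m f) x = x * c ^+ n.
  elim: n => [|n IHn]; first by rewrite mulg1.
  rewrite iterS IHn psiM ?groupX // psix expgS -mulgA; congr (_ * (_ * _)).
  elim: n {IHn} => [|n IHn]; first exact: iter_fix (injhom1 f_hom).
  by rewrite expgS psiM ?groupX // psic IHn.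
by rewrite expnS iterM iter_c expg_cardG ?mulg1 // (subsetP sP).
Qed.

Lemma Aut_pnat_of_conj P : fusion_system S F -> P \subset S ->
  (forall f, f \in F P P ->
     forall x, x \in P -> exists2 s, s \in S & f x = s * x * s^-1) ->
  p.-nat #|F P P|.
Proof.
move=> fusF sP AutP; apply: (Aut_pnat fusF) => // f Ff.
have [k cardS] : exists k, #|S| = (p ^ k)%N by exists (logn p #|S|); apply: card_pgroup.
(* The upper central series reaches [S] at step [nil_class S], so [#|S| ^ nil_class S] iterations
   suffice, a power of [p]. *)
exists (k * nil_class S)%N => x Px; rewrite expnM -cardS.
have f_hom := fus_hom fusF sP sP Ff.
apply: (iter_ucn sP f_hom (AutP f Ff)); rewrite inE Px.
have /(ucn_nil_classP _ (pgroup_nil pS)) -> := leqnn (nil_class S).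
exact: (subsetP sP).
Qed.

(** * From condition (4) to nilpotency, by saturation and descending induction on the order *)

Hypothesis satF : saturated p S F.
Let fusF : fusion_system S F. Proof. by case: satF. Qed.

(** The common inductive step: saturation extends [phi] to [Nphi], which is strictly larger than
    [P], so [big] turns the extension into an [S]-conjugation. *)
Lemma conj_of_Nphi P R phi :
  (forall Q, Q \subset S -> #|P| < #|Q| -> F Q S \subset HomS S Q S) ->
  P \subset S -> phi \in F P S -> R = phi @: P :> {set gT} ->
  fully_centralized S F R -> ~~ (Nphi S P phi \subset P) -> phi \in HomS S P S.
Proof.
move=> big sP Fphi defR fcR nN; have [_ _ ext] := satF.
have [psi Fpsi E] := ext P sP phi Fphi R defR fcR.
pose N := Group (Nphi_group_set S P phi).
have sPN : P \subset N := sub_Nphi fusF sP Fphi.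
have sN : N \subset S by apply/subsetP=> g /NphiP[/setIP[]].
apply: (conj_of_extension fusF sP Fphi sPN) E.
by apply: (subsetP (big N sN _)) => //; rewrite proper_card // properE sPN.
Qed.

Lemma Aut_fully_normalized R :
  (forall Q, Q \subset S -> #|R| < #|Q| -> F Q S \subset HomS S Q S) ->
  (Fcentric S F R -> p.-nat #|F R R|) ->
  R \subset S -> fully_normalized S F R -> F R R = HomS S R R.
Proof.
move=> big pAut sR fnR; have [_ sylR _] := satF.
have [fcR [sAut pAutS p'ind]] := sylR R sR fnR.
have [sCR | nCR] := boolP ('C_S(R) \subset R).
  apply/esym/eqP; rewrite eqEcard sAut /=.
  have pAutF := pAut (fully_centralized_centric fusF sR fcR sCR).
  (* These are plain sets of functions, so divisibility comes from comparing two powers of [p]. The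
     index is then both a [p]-number and prime to [p], hence 1. *)
  have dvdAut : #|HomS S R R| %| #|F R R|.
    case/p_natP: (pAutS) (subset_leq_card sAut) => // a ->.
    case/p_natP: pAutF => // b ->.
    by rewrite leq_exp2l ?prime_gt1 // => /dvdn_exp2l.
  have p_ind : p.-nat (#|F R R| %/ #|HomS S R R|) by apply: pnat_div.
  have /eqP ind1 := pnat_1 p_ind p'ind.
  by rewrite -(divnK dvdAut) (eqP ind1) mul1n.
(* Non-centric case: [Nphi] of [f] contains ['C_S(R)], hence is not contained in [R]. *)
apply/eqP; rewrite eqEsubset sAut andbT; apply/subsetP=> f Ff.
have f_hom := fus_hom fusF sR sR Ff; have [_ _ sfR _] := f_hom.
have defR : R = f @: R :> {set gT}.
  by apply/esym/eqP; rewrite eqEcard sfR (injhom_card f_hom) /=.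
have /HomSP[g [Sg _ Ef]] : f \in HomS S R S.
  apply: (conj_of_Nphi big sR (fus_widen fusF sR sR (subxx S) Ff) defR fcR).
  by apply: contra nCR; apply: subset_trans (cent_sub_Nphi S R f).
by apply/HomSP; exists g; split=> //; rewrite -imset_conjmap -Ef.
Qed.

Lemma iso_fully_normalized P R psi :
  (forall Q, Q \subset S -> #|P| < #|Q| -> F Q S \subset HomS S Q S) ->
  F R R = HomS S R R -> P \subset S -> R \subset S -> fully_normalized S F R ->
  psi \in F P R -> psi @: P = R -> psi \in HomS S P S.
Proof.
move=> big AutR sP sR fnR Fpsi defR; have [_ sylR _] := satF.
have [fcR _] := sylR R sR fnR.
(* For [P = S] no larger subgroup exists, but then [R = S] too and [AutR] applies to [psi].
   Otherwise normalizers grow in the nilpotent group [S]. *)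
have [eqPS | neqPS] := eqVneq P S.
  have eqRP : R = P.
    apply/val_inj/eqP; rewrite /= eqEcard {1}eqPS sR /=.
    by rewrite -defR (injhom_card (fus_hom fusF sP sR Fpsi)).
  by move: Fpsi; rewrite -[in F P R]eqRP AutR eqRP eqPS.
have prP : P \proper S by rewrite properEneq sP andbT.
apply: (conj_of_Nphi big sP (fus_widen fusF sP sR (subxx S) Fpsi) _ fcR) => //.
have := nilpotent_proper_norm (pgroup_nil pS) prP; rewrite properE => /andP[_].
by apply: contra; apply: subset_trans (norm_sub_Nphi fusF sP sR AutR Fpsi defR).
Qed.

Lemma fus_sub_HomS P :
  (forall Q, Fcentric S F Q -> p.-nat #|F Q Q|) ->
  P \subset S -> F P S \subset HomS S P S.
Proof.
move=> pAut; move: {2}_.+1 (ltnSn (#|S| - #|P|)) => n.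
elim: n P => // n IHn P ltn sP.
have big Q : Q \subset S -> #|P| < #|Q| -> F Q S \subset HomS S Q S.
  move=> sQ ltPQ; apply: IHn => //; rewrite -ltnS; apply: leq_trans ltn; rewrite ltnS.
  by rewrite ltn_sub2l // (leq_trans ltPQ) ?subset_leq_card.
apply/subsetP=> phi Fphi.
have [Q [defQ sQ FphiQ _]] := fus_image fusF sP Fphi.
have [R [sR cPR fnR]] := fully_normalized_exists fusF sP.
have cPQ : Fconj_sub F P Q by exists phi.
have cQR := Fconj_trans fusF sQ sP sR (Fconj_sym fusF sP sQ cPQ) cPR.
have AutR : F R R = HomS S R R.
  (* Conjugate subgroups have the same order, so [big] for [P] also serves for [R], and below for
     [Q]. *)
  apply: (Aut_fully_normalized _ (pAut R) sR fnR) => K sK.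
  by rewrite -(Fconj_card fusF sP sR cPR); apply: big.
have [psi Fpsi defR] := cQR.
have /HomSP[h [Sh _ Eh]] : psi \in HomS S Q S.
  apply: (iso_fully_normalized _ AutR sQ sR fnR Fpsi defR) => K sK.
  by rewrite -(Fconj_card fusF sP sQ cPQ); apply: big.
have /HomSP[g [Sg _ Eg]] : compmap P psi phi \in HomS S P S.
  apply: (iso_fully_normalized big AutR) => //; first exact: (fus_comp fusF) Fpsi.
  rewrite -defR defQ -imset_comp; apply: eq_in_imset => x Px.
  exact: compmapE.
have phi_hom := fus_hom fusF sP sQ FphiQ; have [_ _ _ phi1] := phi_hom.
(* [psi] is conjugation by [h] and [psi] after [phi] is conjugation by [g]; cancelling [psi] leaves
   [h^-1 * g]. *)
have Ephi : phi = conjmap P (h^-1 * g).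
  apply/ffunP=> x; have [Px | nPx] := boolP (x \in P); last first.
    by rewrite phi1 // ffunE (negPf nPx).
  rewrite conjmapE // invMg invgK conjgM -[x ^ g^-1](conjmapE g Px) -Eg compmapE //.
  by rewrite Eh conjmapE ?(injhom_mem phi_hom) // conjgKV.
apply/HomSP; exists (h^-1 * g); split; rewrite ?groupM ?groupV //.
by rewrite -imset_conjmap -Ephi -defQ.
Qed.

Lemma nilpotent_of_centric :
  (forall P, Fcentric S F P -> p.-nat #|F P P|) -> nilpotent_fus S F.
Proof.
move=> pAut P Q sP sQ; apply/eqP; rewrite eqEsubset (fus_HomS fusF sP sQ) andbT.
apply/subsetP=> f Ff.
have /HomSP[g [Sg _ Ef]] : f \in HomS S P S.
  by apply: (subsetP (fus_sub_HomS pAut sP)); apply: (fus_widen fusF) Ff.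
have [_ _ sfQ _] := fus_hom fusF sP sQ Ff.
by apply/HomSP; exists g; split=> //; rewrite -imset_conjmap -Ef.
Qed.

(** * Conjugacy of tuples and of single elements *)

Lemma nilpotent_tuple n (a b : n.-tuple gT) : nilpotent_fus S F ->
  commuting_in S a -> (Fconj_tuple F S a b <-> Sconj_tuple S a b).
Proof.
move=> nilF [Sa _]; set A := [set tnth a i | i : 'I_n].
have sA : A \subset S by apply/subsetP=> _ /imsetP[i _ ->].
have Aa i : tnth a i \in <<A>> by rewrite mem_gen ?imset_f.
rewrite /Fconj_tuple -/A nilF ?gen_subG //.
split=> [[phi /HomSP[s [Ss _ ->]] E] | [s Ss E]].
  by exists s => // i; rewrite -E conjmapE ?conjVgE.
exists (conjmap <<A>> s) => [|i]; last by rewrite conjmapE ?conjVgE.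
by apply/HomSP; exists s; split; rewrite // sub_conjgV conjGid ?gen_subG.
Qed.

(** A constant tuple commutes and generates [<[a]>]; positivity of [n] provides an index at which to
    read off the value. *)
Lemma tuple_conj n : 0 < n ->
  (forall a b : n.-tuple gT, commuting_in S a -> commuting_in S b ->
     (Fconj_tuple F S a b <-> Sconj_tuple S a b)) ->
  forall a b, a \in S -> b \in S ->
    (exists2 phi, phi \in F <[a]> S & phi a = b) <->
    (exists2 s, s \in S & b = s * a * s^-1).
Proof.
move=> n_gt0 conjF a b Sa Sb; pose i0 := Ordinal n_gt0.
have tnE (x : gT) i : tnth [tuple x | _ < n] i = x by rewrite tnth_mktuple.
have commS (x : gT) : x \in S -> commuting_in S [tuple x | _ < n].
  by move=> Sx; split=> [i | i j]; rewrite !tnE.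
have genE : <<[set tnth [tuple a | _ < n] i | i : 'I_n]>> = <[a]>.
  congr <<_>>; apply/setP=> x; rewrite inE.
  apply/imsetP/eqP=> [[i _ ->] | ->]; first by rewrite tnE.
  by exists i0; rewrite ?tnE.
have [FS SF] := conjF _ _ (commS a Sa) (commS b Sb).
rewrite /Fconj_tuple genE in FS SF.
split=> [[phi Fphi Eb] | [s Ss Eb]].
  have [|s Ss E] := FS; first by exists phi => // i; rewrite !tnE.
  by exists s => //; have := E i0; rewrite !tnE.
have [|phi Fphi E] := SF; first by exists s => // i; rewrite !tnE.
by exists phi => //; have := E i0; rewrite !tnE.
Qed.

(** Restricting an automorphism [f] of [P] to [<[x]>] shows that [x] and [f x] are [F]-conjugate,
    hence [S]-conjugate. *)
Lemma Aut_pnat_of_elt_conj P :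
  (forall a b, a \in S -> b \in S ->
    (exists2 phi, phi \in F <[a]> S & phi a = b) <->
    (exists2 s, s \in S & b = s * a * s^-1)) ->
  P \subset S -> p.-nat #|F P P|.
Proof.
move=> conjF sP; apply: Aut_pnat_of_conj => // f Ff x Px.
have f_hom := fus_hom fusF sP sP Ff.
apply/conjF; rewrite ?(subsetP sP) ?(injhom_mem f_hom) //.
have sxP : <[x]> \subset P by rewrite cycle_subG.
have [f' Ff' E] := fus_restr fusF sxP sP (subxx S) (fus_widen fusF sP sP (subxx S) Ff).
by exists f'; rewrite // E ?cycle_id.
Qed.

End Nilpotency.

Theorem theorem4p8 (gT : finGroupType) (p : nat) (S : {group gT})
  (F : {set gT} -> {set gT} -> {set {ffun gT -> gT}})
  (L : linking_data gT) :
  prime p -> p.-group S -> saturated p S F -> linking_system S F L ->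
  [/\ nilpotent_fus S F <->
        (forall a b, a \in S -> b \in S ->
           (exists2 phi, phi \in F <[a]> S & phi a = b) <->
           (exists2 s, s \in S & b = s * a * s^-1)),
      nilpotent_fus S F <->
        (exists2 n, 1 < n & forall a b : n.-tuple gT,
           commuting_in S a -> commuting_in S b ->
           (Fconj_tuple F S a b <-> Sconj_tuple S a b)),
      nilpotent_fus S F <->
        (forall P : {group gT}, P \subset S -> p.-nat #|F P P|) &
      nilpotent_fus S F <->
        (forall P : {group gT}, Fcentric S F P -> p.-nat #|F P P|)].
Proof.
move=> p_pr pS satF _.
set c1 := (c1 in _ <-> c1).
have nil1 : nilpotent_fus S F -> c1.
  (* Condition (1) is read off from tuples of length 1. *)
  move=> nilF; apply: (@tuple_conj _ _ _ 1) => // a b Sa _.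
  exact: nilpotent_tuple.
have one3 : c1 -> forall P : {group gT}, P \subset S -> p.-nat #|F P P|.
  by move=> H P; apply: (Aut_pnat_of_elt_conj p_pr pS satF).
have three4 : (forall P : {group gT}, P \subset S -> p.-nat #|F P P|) ->
    forall P : {group gT}, Fcentric S F P -> p.-nat #|F P P|.
  by move=> H P [sP _]; apply: H.
have four := nilpotent_of_centric p_pr pS satF.
(* The implications form the cycle nilpotent, (1), (3), (4), nilpotent; (2) follows from nilpotency
   with [n = 2] and yields (1). *)
split; split.
- exact: nil1.
- by move=> /one3/three4/four.
- by move=> nilF; exists 2 => // a b Sa _; apply: nilpotent_tuple.
- case=> n n_gt1 /(tuple_conj (ltnW n_gt1)).
  by move=> /one3/three4/four.
- by move=> /nil1/one3.
- by move=> /three4/four.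
- by move=> /nil1/one3/three4.
- exact: four.
Qed.
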